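(* There exist a constant $\gamma \geq 0.0089$ and a constant $C$ such that for every positive integer $n$, $$W(n) \leq n^{1/2} + n^{1/4}(\sqrt{3}-\gamma) + C,$$ where $W(n)$ denotes the maximum cardinality of a weak Sidon set contained in $\{1,2,\dots,n\}$.
   Context: A set of integers $A=\{a_1<a_2<\dots<a_k\}$ is a weak Sidon set if all the pairwise sums $a_i+a_j$ with $i<j$ are different (i.e., sums of two distinct elements of $A$ are all distinct). For a positive integer $n$, $W(n)$ is the maximum size of a weak Sidon set contained in $\{1,2,\dots,n\}$. The statement in the paper is written with an $O(1)$ error term, which here is made explicit as an absolute constant $C$. *)

(* Defs.v *)
From mathcomp Require Import all_boot all_order all_algebra.
From mathcomp Require Import finmap.
From mathcomp Require Import all_classical all_reals all_analysis.

Set Implicit Arguments.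
Unset Strict Implicit.
Unset Printing Implicit Defensive.

Import Order.TTheory GRing.Theory Num.Theory.

Local Open Scope fset_scope.
Local Open Scope ring_scope.

Definition weak_sidon (A : {fset int}) : bool :=
  [forall a : A, forall b : A, forall c : A, forall d : A,
    [&& val a < val b, val c < val d & val a + val b == val c + val d] ==>
    ((a == c) && (b == d))].

Definition interval1 (n : nat) : {fset int} := [fset k%:Z | k in iota 1 n].

Definition W (n : nat) : nat :=
  (\max_(A <- fpowerset (interval1 n) | weak_sidon A) #|` A|)%N.

Lemma weak_sidonP (A : {fset int}) :
  reflect (forall a b c d : int,
             a \in A -> b \in A -> c \in A -> d \in A ->
             a < b -> c < d -> a + b = c + d -> a = c /\ b = d)
          (weak_sidon A).
Proof.
apply: (iffP forallP) => [h a b c d aA bA cA dA ab cd e | h a].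
  move: h => /(_ [` aA]) /forallP /(_ [` bA]) /forallP /(_ [` cA]) /forallP.
  move=> /(_ [` dA]) /=; rewrite ab cd e eqxx /= => /andP[].
  by move=> /eqP[->] /eqP[->].
apply/forallP => b; apply/forallP => c; apply/forallP => d.
apply/implyP => /and3P[ab cd /eqP e].
have [/val_inj -> /val_inj ->] :=
  h _ _ _ _ (valP a) (valP b) (valP c) (valP d) ab cd e.
by rewrite !eqxx.
Qed.

Lemma in_interval1 (n : nat) (x : int) :
  (x \in interval1 n) = (1 <= x) && (x <= n%:Z).
Proof.
apply/imfsetP/idP => [[k /=]|].
  by rewrite mem_iota add1n ltnS => kn ->; rewrite !lez_nat.
case: x => // k; rewrite !lez_nat => kn.
by exists k => //=; rewrite mem_iota add1n ltnS.
Qed.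

Lemma W_ge (n : nat) (A : {fset int}) :
  A `<=` interval1 n -> weak_sidon A -> (#|` A| <= W n)%N.
Proof.
move=> An wA; rewrite /W (big_rem A) /=; last by rewrite fpowersetE.
by rewrite wA leq_maxl.
Qed.

Lemma W_attained (n : nat) :
  exists A : {fset int}, [/\ A `<=` interval1 n, weak_sidon A & #|` A| = W n].
Proof.
rewrite /W big_seq_cond.
apply: (big_ind (fun m => exists A : {fset int},
  [/\ A `<=` interval1 n, weak_sidon A & #|` A| = m])).
- exists fset0; rewrite fsub0set cardfs0; split => //.
  by apply/weak_sidonP => a b c d; rewrite in_fset0.
- move=> x y hx hy; rewrite /maxn; by case: ifP.
- by move=> A /andP[]; rewrite fpowersetE => An wA; exists A.
Qed.

(* Main.v *)
(** Let [A] be a weak Sidon set in [[1, n]] with [k] elements, and let [B_T x]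
count the elements of [A] in the window [(x - T, x]]. A difference occurs at
most twice, and twice only along a three-term progression, of which there is at
most one per midpoint; hence [sum B_T^2 <= T^2 + 3 k T], while [sum B_T = k T].
This bounds [sum (B_T - l)^2] for the expected count [l = T / sqrt n]; merely
using that this sum is nonnegative would give the constant [sqrt 3]. To do
better, take the lengths [T] and [2 T] with [T = n^(3/4)] together. Windows
overhanging an end of [[1, n]] hold the same elements for both lengths, so
there the counts cannot be close to both [l] and [2 l], and the two sums add up
to at least [T l^2]. This yields [k <= n^(1/2) + 1.7 n^(1/4) + O(1)]. *)
Require Import Defs.
From mathcomp Require Import all_boot all_order all_algebra.
From mathcomp Require Import finmap.
From mathcomp Require Import all_classical all_reals all_analysis.
From mathcomp Require Import zify ring lra.

Import Order.TTheory GRing.Theory Num.Theory.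

Local Open Scope ring_scope.

(** * Window counts and their first two moments *)

Definition nat_weak_sidon {m : nat} (A : {set 'I_m}) : Prop :=
  forall a b c d : 'I_m, a \in A -> b \in A -> c \in A -> d \in A ->
    (a < b)%N -> (c < d)%N -> (a + b = c + d)%N -> a = c /\ b = d.

Definition window_count {m : nat} (A : {set 'I_m}) (T x : nat) : nat :=
  (\sum_(a in A) (a <= x < a + T))%N.

Lemma sum_interval_indicator (lo hi M : nat) : (0 < lo)%N ->
  (\sum_(1 <= x < M.+1) (lo <= x < hi) = minn hi M.+1 - lo)%N.
Proof.
move=> lo_gt0; elim: M => [|M IH]; first by rewrite big_geq //; lia.
rewrite big_nat_recr //= IH.
by case: (leqP lo M.+1) => /=; case: (ltnP M.+1 hi) => /=; lia.
Qed.

Lemma sum_window_count {n : nat} (A : {set 'I_n.+1}) (T : nat) :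
  {in A, forall a : 'I_n.+1, 0 < a}%N -> (0 < n)%N ->
  (\sum_(1 <= x < n + T) window_count A T x = #|A| * T)%N.
Proof.
move=> Apos n_gt0; rewrite /window_count exchange_big /= -sum_nat_const.
apply: eq_bigr => a aA; have an := ltn_ord a.
have -> : (n + T = (n + T).-1.+1)%N by lia.
by rewrite sum_interval_indicator ?Apos //; lia.
Qed.

(** Expanding the square counts pairs seen by a common window; the end points of windows holding
    both [a] and [b] run from [maxn a b] to below [minn a b + T]. *)
Lemma sum_window_count_sqr {n : nat} (A : {set 'I_n.+1}) (T : nat) :
  {in A, forall a : 'I_n.+1, 0 < a}%N -> (0 < n)%N ->
  (\sum_(1 <= x < n + T) window_count A T x ^ 2 =
   \sum_(a in A) \sum_(b in A) (T - (maxn a b - minn a b)))%N.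
Proof.
move=> Apos n_gt0.
under eq_bigr => x _ do
  rewrite /window_count expnS expn1 big_distrl /=.
rewrite exchange_big /=; apply: eq_bigr => a aA.
under eq_bigr => x _ do rewrite big_distrr /=.
rewrite exchange_big /=; apply: eq_bigr => b bA.
have an := ltn_ord a; have bn := ltn_ord b.
have a0 := Apos _ aA; have b0 := Apos _ bA.
under eq_bigr => x _.
  have -> : ((a <= x < a + T) * (b <= x < b + T) =
             (maxn a b <= x < minn a b + T))%N.
    by rewrite -mulnb !(geq_max, mulnb); congr nat_of_bool; lia.
  over.
have -> : (n + T = (n + T).-1.+1)%N by lia.
by rewrite sum_interval_indicator; lia.
Qed.

(** * Sums over differences *)

Lemma sum_triangle (m T : nat) :
  (2 * \sum_(d < m | 0 < d) (T - d) <= T ^ 2)%N.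
Proof.
(* The second summand is twice the sum of the terms after [N], so the left side keeps the value
   [T * T.-1]. *)
have H N : (2 * (\sum_(0 <= d < N.+1 | 0 < d) (T - d)) +
             (T - N) * (T - N).-1 <= T ^ 2)%N.
  elim: N => [|N IH]; first by rewrite big_mkcond big_nat1 /=; nia.
  rewrite big_mkcond big_nat_recr //= -big_mkcond /= subnS.
  by case: (T - N)%N IH => [|[|u]] /=; nia.
rewrite -(big_mkord (fun d => 0 < d)%N (fun d => T - d)%N).
by case: m => [|m]; [rewrite big_geq|move: (H m); lia].
Qed.

(* Two pairs with the same difference must overlap, so a pair [(a, b)] that is
   not the lower half of a three-term progression is determined by [b - a]. *)
Lemma sum_pairs_le {m : nat} (A : {set 'I_m}) (T : nat) :
  nat_weak_sidon A ->
  (2 * \sum_(a in A) \sum_(b in A | a < b) (T - (b - a)) <=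
   T ^ 2 + 2 * (#|A| * T))%N.
Proof.
move=> sidA.
pose P := [set p : 'I_m * 'I_m | [&& p.1 \in A, p.2 \in A & (p.1 < p.2)%N]].
pose mid := [set p : 'I_m * 'I_m |
  [exists c in A, p.2 + p.2 == p.1 + c]]%N.
have -> : (\sum_(a in A) \sum_(b in A | a < b) (T - (b - a)) =
           \sum_(p in P) (T - (p.2 - p.1)))%N.
  by rewrite pair_big_dep /=; apply: eq_bigl => p; rewrite inE.
rewrite (big_setID mid) /= mulnDr addnC leq_add //.
- have dm (p : 'I_m * 'I_m) : (p.2 - p.1 < m)%N.
    by have := ltn_ord p.2; lia.
  pose h p := Ordinal (dm p).
  have hinj : {in P :\: mid &, injective h}.
    move=> [a b] [c d]; rewrite !inE /= => /andP[/existsP nab /and3P[aA bA ab]].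
    move=> /andP[/existsP ncd /and3P[cA dA cd]] /(congr1 val) /= e.
    have [da|nda] := eqVneq (d : nat) a.
      by case: ncd; exists b; rewrite bA /=; apply/eqP; lia.
    have [bc|nbc] := eqVneq (b : nat) c.
      by case: nab; exists d; rewrite dA /=; apply/eqP; lia.
    have [ac|ac] := eqVneq (a : nat) c.
      by congr pair; apply: val_inj => /=; lia.
    (* Now [a + d = b + c] with distinct summands on each side; every order of them contradicts
       [sidA] or is impossible. *)
    have [lad|lad] := ltnP a d; have [lbc|lbc] := ltnP b c; try lia.
    - by have [|ba dc] := sidA a d b c aA dA bA cA lad lbc; [lia|subst; lia].
    - have lcb : (c < b)%N by lia.
      by have [|ba dc] := sidA a d c b aA dA cA bA lad lcb; [lia|subst; lia].
    have lda : (d < a)%N by lia.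
    have lcb : (c < b)%N by lia.
    by have [|ba dc] := sidA d a c b dA aA cA bA lda lcb; [lia|subst; lia].
  apply: leq_trans (sum_triangle m T); rewrite leq_mul2l /=.
  rewrite -(big_imset (fun d : 'I_m => (T - d)%N) hinj) /=.
  rewrite [X in (_ <= X)%N](bigID (mem (h @: (P :\: mid)))) /=.
  rewrite (eq_bigl (fun d : 'I_m => (0 < d)%N && (d \in h @: (P :\: mid))));
    first exact: leq_addr.
  move=> d; case: imsetP => [[[a b]]|_]; rewrite ?andbF // andbT.
  by rewrite !inE /= => /andP[_ /and3P[_ _ ab]] ->; rewrite /= subn_gt0.
- rewrite leq_mul2l /=.
  (* A midpoint [b] fixes its progression: [a + x = b + b = c + y] forces [a = c]. *)
  have sinj : {in P :&: mid &, injective (fun p : 'I_m * 'I_m => p.2)}.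
    move=> [a b] [c d]; rewrite !inE /=.
    move=> /andP[/and3P[aA bA ab] /existsP[x /andP[xA /eqP ex]]].
    move=> /andP[/and3P[cA dA cd] /existsP[y /andP[yA /eqP ey]]] ebd; subst d.
    by have [||| -> //] := sidA a x c y aA xA cA yA; lia.
  apply: (@leq_trans (\sum_(p in P :&: mid) T)%N).
    by apply: leq_sum => p _; apply: leq_subr.
  rewrite sum_nat_const leq_mul2r; apply/orP; right.
  rewrite -(card_in_imset sinj); apply: subset_leq_card; apply/fintype.subsetP => b.
  by move=> /imsetP[[a c]]; rewrite !inE => /andP[/and3P[_ ? _] _] /= ->.
Qed.

(** The diagonal gives [#|A| * T]; the rest is twice the sum over [a < b]. *)
Lemma sum_overlaps_le {m : nat} (A : {set 'I_m}) (T : nat) :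
  nat_weak_sidon A ->
  (\sum_(a in A) \sum_(b in A) (T - (maxn a b - minn a b)) <=
   T ^ 2 + 3 * (#|A| * T))%N.
Proof.
move=> sidA; have := @sum_pairs_le _ A T sidA.
set S := (\sum_(a in A) \sum_(b in A | a < b) _)%N => HS.
have -> : (\sum_(a in A) \sum_(b in A) (T - (maxn a b - minn a b)) =
           #|A| * T + S + S)%N.
  have S' : (S = \sum_(a in A) \sum_(b in A | b < a) (T - (a - b)))%N.
    rewrite /S (exchange_big_dep (mem A)) /= => [|a b _ /andP[] //].
    by apply: eq_bigr => a aA; apply: eq_bigl => b; rewrite aA.
  rewrite {2}S' /S -sum_nat_const -!big_split /=; apply: eq_bigr => a aA.
  rewrite (bigD1 a) //= maxnn minnn subnn subn0 -addnA; congr addn.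
  rewrite (bigID (fun b : 'I_m => a < b)%N) /=; congr addn.
    apply: eq_big => [b|b /andP[_ ab]]; last by congr subn; lia.
    by rewrite -andbA; congr andb; rewrite -val_eqE /=; lia.
  apply: eq_big => [b|b /andP[_ ab]]; last by congr subn; lia.
  by rewrite -andbA; congr andb; rewrite -val_eqE /=; lia.
lia.
Qed.

(** * Overhanging windows and deviations from an expected count *)

Lemma window_count_left {n : nat} (A : {set 'I_n.+1}) (T T' x : nat) :
  {in A, forall a : 'I_n.+1, 0 < a}%N -> (x <= T)%N -> (x <= T')%N ->
  window_count A T x = window_count A T' x.
Proof.
move=> Apos xT xT'; apply: eq_bigr => a /Apos a0; congr nat_of_bool; lia.
Qed.

Lemma window_count_right {n : nat} (A : {set 'I_n.+1}) (T T' x : nat) :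
  (n <= x + T)%N -> (n <= x + T')%N ->
  window_count A T (x + T) = window_count A T' (x + T').
Proof.
move=> xT xT'; apply: eq_bigr => a _; have := ltn_ord a => an.
congr nat_of_bool; lia.
Qed.

Definition window_variance {R : pzRingType} {n : nat} (A : {set 'I_n.+1})
    (T : nat) (l : R) : R :=
  \sum_(1 <= x < n + T) ((window_count A T x)%:R - l) ^+ 2.

Lemma window_variance_le {R : realFieldType} {n : nat} (A : {set 'I_n.+1})
    (T : nat) (l : R) :
  nat_weak_sidon A -> {in A, forall a : 'I_n.+1, 0 < a}%N -> (0 < n)%N ->
  window_variance A T l <= T%:R ^+ 2 + 3 * #|A|%:R * T%:R
    - 2 * l * #|A|%:R * T%:R + l ^+ 2 * (n%:R + T%:R).
Proof.
move=> sidA Apos n_gt0; rewrite /window_variance.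
have -> : \sum_(1 <= x < n + T) ((window_count A T x)%:R - l) ^+ 2 =
    (\sum_(1 <= x < n + T) window_count A T x ^ 2)%N%:R
    - 2 * l * (\sum_(1 <= x < n + T) window_count A T x)%N%:R
    + l ^+ 2 * (n + T - 1)%N%:R.
  rewrite [l ^+ 2 * _]mulr_natr -sumr_const_nat !natr_sum mulr_sumr.
  rewrite -sumrB -big_split /=.
  by apply: eq_bigr => x _; rewrite natrX; ring.
rewrite sum_window_count // sum_window_count_sqr //.
have := @sum_overlaps_le _ A T sidA; rewrite -(ler_nat R) !(natrD, natrM, natrX).
have : l ^+ 2 * (n + T - 1)%N%:R <= l ^+ 2 * (n%:R + T%:R).
  by rewrite ler_wpM2l ?sqr_ge0 // -natrD ler_nat leq_subr.
lra.
Qed.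

(* Overhanging windows of lengths [T] and [2 * T] that reach equally far into
   [[1, n]] have the same count, which cannot be close to both [l] and [2 * l];
   there are [T] such positions at each end. *)
Lemma window_variance_ge {R : realFieldType} {n : nat} (A : {set 'I_n.+1})
    (T : nat) (l : R) :
  {in A, forall a : 'I_n.+1, 0 < a}%N -> (T < n)%N ->
  T%:R * l ^+ 2 <= window_variance A T l + window_variance A (2 * T) (2 * l).
Proof.
move=> Apos Tn; rewrite /window_variance.
(* The two end ranges are disjoint because [T < n]. On the right, [x] marks the left end of the
   window, so that both lengths are compared at the same [x]. *)
have split_ge (T' : nat) (l' : R) : (T <= T')%N ->
    \sum_(1 <= x < T.+1) ((window_count A T' x)%:R - l') ^+ 2 +
    \sum_(n - T <= x < n) ((window_count A T' (x + T'))%:R - l') ^+ 2 <=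
    \sum_(1 <= x < n + T') ((window_count A T' x)%:R - l') ^+ 2.
  move=> TT'.
  rewrite (@big_cat_nat _ _ _ T.+1 1 (n + T')) //=; last by lia.
  rewrite lerD2l (@big_cat_nat _ _ _ (n - T + T') T.+1 (n + T')) //=; try lia.
  rewrite big_addn addnK.
  by rewrite lerDr sumr_ge0 // => x _; apply: sqr_ge0.
apply: le_trans (lerD (split_ge _ _ (leqnn T)) (split_ge _ _ _)); last by lia.
rewrite addrACA -!big_split /=.
(* The minimum is attained at [b = 3 l / 2]. *)
have half (b : R) : l ^+ 2 / 2 <= (b - l) ^+ 2 + (b - 2 * l) ^+ 2.
  by have := sqr_ge0 (2 * b - 3 * l); nra.
apply: (@le_trans _ _ (\sum_(1 <= x < T.+1) (l ^+ 2 / 2)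
                       + \sum_(n - T <= x < n) (l ^+ 2 / 2))).
  by rewrite !sumr_const_nat subn1 subKn ?(ltnW Tn) // -mulr_natl; lra.
apply: lerD; apply: ler_sum_nat => x /andP[x1 x2].
  by rewrite (@window_count_left _ _ T (2 * T)) //; lia.
by rewrite (@window_count_right _ _ T (2 * T)) //; lia.
Qed.

(** Add the upper bounds for [T], [l] and for [2 T], [2 l], compare with the lower bound and divide
    by [T]. For [l] near n^(1/4) and [#|A|] near [s], the right side is about 17 n^(1/2), whence the
    constant 17/10. *)
Lemma card_weak_sidon_window {R : realFieldType} {n : nat} (A : {set 'I_n.+1})
    (T : nat) (s : R) :
  nat_weak_sidon A -> {in A, forall a : 'I_n.+1, 0 < a}%N ->
  (0 < T < n)%N -> 0 < s -> s ^+ 2 = n%:R ->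
  10 * (T%:R / s) * (#|A|%:R - s) <= 9 * #|A|%:R + 8 * (T%:R / s) ^+ 2.
Proof.
move=> sidA Apos /andP[T_gt0 Tn] s_gt0 s2; set l := T%:R / s.
have n_gt0 : (0 < n)%N by lia.
have lT : T%:R = l * s by rewrite /l divfK // gt_eqF.
have T0 : 0 < T%:R :> R by rewrite ltr0n.
have := @window_variance_ge R n A T l Apos Tn.
have := @window_variance_le R n A T l sidA Apos n_gt0.
have := @window_variance_le R n A (2 * T) (2 * l) sidA Apos n_gt0.
move: (window_variance A T l) (window_variance A (2 * T) (2 * l)) => v w.
rewrite natrM -s2 => hw hv hvw.
suff : 0 <= T%:R * (9 * #|A|%:R + 8 * l ^+ 2 - 10 * l * (#|A|%:R - s)).
  by rewrite pmulr_rge0 // subr_ge0.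
have e : l ^+ 2 * s ^+ 2 = T%:R ^+ 2 by rewrite lT; ring.
have e' : T%:R * l * s = T%:R ^+ 2 by rewrite lT; ring.
have -> : T%:R * (9 * #|A|%:R + 8 * l ^+ 2 - 10 * l * (#|A|%:R - s)) =
  9 * #|A|%:R * T%:R + 8 * (T%:R * l ^+ 2) - 10 * (l * #|A|%:R * T%:R)
  + 10 * (T%:R * l * s) by ring.
move: l lT e e' hw hv hvw => l _ e e' hw hv hvw.
lra.
Qed.

(** * Transfer to ordinals and choice of parameters *)

Lemma weak_sidon_ordinals (n : nat) (A : {fset int}) :
  fsubset A (interval1 n) -> weak_sidon A ->
  exists B : {set 'I_n.+1}, [/\ nat_weak_sidon B,
    {in B, forall a : 'I_n.+1, 0 < a}%N & (#|` A| <= #|B|)%N].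
Proof.
move=> /fsubsetP An /weak_sidonP sidA.
exists [set i : 'I_n.+1 | (i : nat)%:Z \in A]; split.
- move=> a b c d; rewrite !inE => aA bA cA dA ab cd e.
  have [||| [ac] [bd]] := sidA _ _ _ _ aA bA cA dA; try lia.
  by split; apply: val_inj.
- by move=> a; rewrite inE => /An; rewrite in_interval1; lia.
set B := [set i : 'I_n.+1 | _].
have /fsubset_leq_card : fsubset A [fset (i : nat)%:Z | i : 'I_n.+1 in B]%fset.
  apply/fsubsetP => x xA; have := An _ xA; rewrite in_interval1 => xn.
  apply/imfsetP => /=; have xn' : (`|x| < n.+1)%N by lia.
  by exists (Ordinal xn') => /=; [rewrite inE /= (_ : `|x|%N%:Z = x) //|]; lia.
move=> h; apply: leq_trans h _; apply: leq_trans (leq_imfset_card _ _ _) _.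
by rewrite cardE; apply: eq_leq; congr size; apply: eq_enum.
Qed.

Theorem theorem5p1 (R : realType) :
  exists gamma C : R,
    89 / 10 ^+ 4 <= gamma /\
    forall n : nat, (0 < n)%N ->
      (W n)%:R <= n%:R `^ (1 / 2) + n%:R `^ (1 / 4) * (Num.sqrt 3 - gamma) + C.
Proof.
(* The coefficient of n^(1/4) becomes 17/10; the generous 40 covers small [n] and the rounding of
   [T]. *)
exists (Num.sqrt 3 - 17 / 10), 40; split.
  have s3 : Num.sqrt 3 ^+ 2 = 3 :> R by rewrite sqr_sqrtr.
  have s0 : 0 <= Num.sqrt 3 :> R by apply: sqrtr_ge0.
  nra.
move=> n n_gt0; rewrite subKr.
pose q : R := n%:R `^ (1 / 4).
have n1 : 1 <= n%:R :> R by rewrite ler1n.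
have q2 : n%:R `^ (1 / 2) = q ^+ 2.
  by rewrite /q -powR_mulrn ?powR_ge0 // -powRrM; congr (_ `^ _); lra.
have q4 : q ^+ 4 = n%:R.
  rewrite /q -powR_mulrn ?powR_ge0 // -powRrM.
  by rewrite (_ : 1 / 4 * 4 = 1) ?powRr1 //; lra.
have q0 : 0 <= q by apply: powR_ge0.
have q1 : 1 <= q by rewrite -(@expr_ge1 _ 4) // q4.
rewrite q2 -/q; have q2_ge0 : 0 <= q ^+ 2 by apply: sqr_ge0.
have [A [An sidA <-]] := W_attained n.
have [B [sidB Bpos cardB]] := weak_sidon_ordinals _ _ An sidA.
have {cardB} : #|` A|%:R <= #|B|%:R :> R by rewrite ler_nat.
have Bn : #|B|%:R <= n%:R + 1 :> R.
  by rewrite natr1 ler_nat; have := max_card (mem B); rewrite card_ord.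
set k : R := #|B|%:R in Bn *; move=> Ak; apply: le_trans Ak _.
have [n16|n16] := leqP n 16.
  by have : n%:R <= 16 :> R; [rewrite ler_nat|lra].
have [kq|kq] := leP k (q ^+ 2); first by lra.
have q2le : 2 <= q.
  rewrite leNgt; apply/negP => q2l; have : q ^+ 4 < 2 ^+ 4 by apply: ltrXn2r.
  by rewrite q4 -natrX ltr_nat; lia.
(* Rounding n^(3/4) up ensures [q <= l]. *)
pose T := (Num.truncn (q ^+ 3)).+1.
have /andP[Tl Tu] := truncn_itv (exprn_ge0 3 q0).
have TR : T%:R = (Num.truncn (q ^+ 3))%:R + 1 :> R by rewrite -natr1.
have T_ge : q ^+ 3 <= T%:R by rewrite ltW.
have T_le : T%:R <= q ^+ 3 + 1 by lra.
have Tn : (0 < T < n)%N.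
  rewrite /= -(ltr_nat R) -q4; apply: le_lt_trans T_le _.
  have : 0 < q ^+ 3 - 1 by rewrite subr_gt0 exprn_egt1 //; lra.
  by have -> : q ^+ 4 = q * q ^+ 3 by []; nra.
have q2_gt0 : 0 < q ^+ 2 by rewrite exprn_gt0 //; lra.
have := @card_weak_sidon_window R n B T _ sidB Bpos Tn q2_gt0.
rewrite -exprM q4 => /(_ erefl).
set l := T%:R / q ^+ 2.
have l_ge : q <= l by rewrite ler_pdivlMr // -exprS.
have l_le : l * q <= q ^+ 2 + 1.
  have : l * q ^+ 2 <= q ^+ 3 + 1 by rewrite divfK ?gt_eqF.
  nra.
rewrite -/k => main.
have l2 : l ^+ 2 <= q ^+ 2 + 3 by nra.
(* As [k > q ^+ 2], the factor [l] on the left of [main] may be lowered to [q]; then 9 (k - q^2) is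
   moved to the left. *)
have : (10 * q - 9) * (k - q ^+ 2) <= 17 * q ^+ 2 + 24 by nra.
nra.
Qed.
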